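(* Let $M$ be a real $n\times n$ matrix (rows and columns indexed by $J=\{0,\dots,n-1\}$). If $M$ is not a permuted a-Monge matrix, then there exists a set of indices $B\subseteq J$ with $|B|\le 4$ such that the submatrix $M[B]$ is not a permuted a-Monge matrix.
   Context: A square real matrix $N$ with rows and columns indexed by $\{0,\dots,k-1\}$ is a-Monge if $N(i,s)+N(r,j)\le N(i,j)+N(r,s)$ for all $i<r$ and $j<s$. A square matrix $M$ is a permuted a-Monge matrix if there is a permutation $\pi$ of its index set such that the matrix $N(i,j)=M(\pi(i),\pi(j))$ (rows and columns permuted simultaneously by the same permutation) is a-Monge. For $B\subseteq J$, $M[B]$ denotes the square submatrix of $M$ formed by the rows and columns with indices in $B$ (in their original relative order). *)

(* Defs.v *)
From mathcomp Require Import all_boot all_order all_fingroup all_algebra.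
From mathcomp Require Import reals.

Set Implicit Arguments.
Unset Strict Implicit.
Unset Printing Implicit Defensive.

Import Order.TTheory GRing.Theory Num.Theory.
Local Open Scope ring_scope.

Definition a_monge (R : realType) (k : nat) (N : 'M[R]_k) : Prop :=
  forall i r j s : 'I_k, (i < r)%N -> (j < s)%N ->
    N i s + N r j <= N i j + N r s.

Definition permuted_a_monge (R : realType) (k : nat) (M : 'M[R]_k) : Prop :=
  exists pi : 'S_k, a_monge (\matrix_(i, j) M (pi i) (pi j)).

(* [enum_val] enumerates a set of ordinals in increasing order, so rows and
   columns keep their original relative order. *)
Definition principal_submx (R : realType) (n : nat) (M : 'M[R]_n)
    (B : {set 'I_n}) : 'M[R]_#|B| :=
  mxsub (@enum_val _ (mem B)) (@enum_val _ (mem B)) M.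

(* Main.v *)
Require Import Defs.
From mathcomp Require Import all_boot all_order all_fingroup all_algebra.
From mathcomp Require Import reals.
From mathcomp Require Import boolp lra.

Set Implicit Arguments.
Unset Strict Implicit.
Unset Printing Implicit Defensive.

Import Order.TTheory GRing.Theory Num.Theory.
Local Open Scope ring_scope.

(** Put d(x,y) = M(x,x) + M(y,y) - M(x,y) - M(y,x).  For M + M^T the a-Monge
    inequality reads d(i,j) + d(r,s) <= d(i,s) + d(r,j), and on four points M
    and M + M^T impose the same constraints on an order, so only d matters.  In
    a valid order the two extreme points a, z maximise d, and any other point x
    is placed by f(x) = d(a,x) - d(z,x).  Conversely choose (a,z) maximising d
    and sort by f.  On four points with a maximal pair p, q, the order p, x, y, q
    is valid as soon as d(p,x) - d(q,x) <= d(p,y) - d(q,y).  Applying this to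
    {a,z,x,y}, then to {a,x,y,t} and {x,y,t,z}, and finally to {x,y,t,u}, shows
    that sorting by f is valid for all triples and then all quadruples. *)

Definition quad_ordered (R : realFieldType) (T : Type) (d : T -> T -> R)
    (i r j s : T) : Prop :=
  d i j + d r s <= d i s + d r j.

(** The ranking [rho] encodes an order on the four points. Ties are allowed and force equality; the
    points may coincide, so pairs and triples are covered too. *)
Definition locally_orderable (R : realFieldType) (T : eqType)
    (d : T -> T -> R) : Prop :=
  forall w x y z : T, exists rho : T -> nat,
    {in [:: w; x; y; z] & &, forall i r j, {in [:: w; x; y; z], forall s,
      (rho i <= rho r)%N -> (rho j <= rho s)%N -> quad_ordered d i r j s}}.

(** Comparing the pair [x, y] with itself gives [d x x + d y y <= d x y + d y x]. *)
Lemma locally_orderable_ge0 (R : realFieldType) (T : eqType) (d : T -> T -> R)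
    (d0 : forall x, d x x = 0) (dC : forall x y, d x y = d y x)
    (loc : locally_orderable d) (x y : T) :
  0 <= d x y.
Proof.
have [rho /(_ _ _ _) H] := loc x x y y.
have inx : x \in [:: x; x; y; y] by rewrite !inE eqxx.
have iny : y \in [:: x; x; y; y] by rewrite !inE eqxx !orbT.
have := dC x y; have := d0 x; have := d0 y.
have [le_xy|/ltnW le_yx] := leqP (rho x) (rho y).
  by have := H x y x inx iny inx y iny le_xy le_xy; rewrite /quad_ordered; lra.
by have := H y x y iny inx iny x inx le_yx le_yx; rewrite /quad_ordered; lra.
Qed.

(** The last hypothesis is itself the inequality for the pairs [p, q] and [x, y]. Linear arithmetic
    gives the conclusions under each possible local order. *)
Lemma locally_orderable_extremal (R : realFieldType) (T : eqType)
    (d : T -> T -> R) (d0 : forall x, d x x = 0)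
    (dC : forall x y, d x y = d y x) (loc : locally_orderable d)
    (p x y q : T) :
  d p x <= d p q -> d p y <= d p q -> d x q <= d p q -> d y q <= d p q ->
  d x y <= d p q -> d p x - d x q <= d p y - d y q ->
  [/\ d p x + d x y <= d p y, d x y + d y q <= d x q
    & d p y + d x q <= d p q + d x y].
Proof.
move=> px py xq yq xy fxy; have [rho H0] := loc p x y q.
(* Only whether the two rank comparisons agree matters: disagreement reverses the inequality. *)
have {H0} H i r j s : i \in [:: p; x; y; q] -> r \in [:: p; x; y; q] ->
    j \in [:: p; x; y; q] -> s \in [:: p; x; y; q] ->
    if (rho i <= rho r)%N == (rho j <= rho s)%N
    then d i j + d r s <= d i s + d r j else d i s + d r j <= d i j + d r s.
  move=> iP rP jP sP; have h1 := H0 i r j iP rP jP s sP.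
  have h2 := H0 r i j rP iP jP s sP; have h3 := H0 i r s iP rP sP j jP.
  have h4 := H0 r i s rP iP sP j jP; move: h1 h2 h3 h4; rewrite /quad_ordered.
  case: (leqP (rho i)) => [_|/ltnW ->]; case: (leqP (rho j)) => [_|/ltnW ->] /=.
  - by move=> /(_ isT isT).
  - by move=> _ _ /(_ isT isT).
  - by move=> _ /(_ isT isT); lra.
  - by move=> _ _ _ /(_ isT isT); lra.
have inp : p \in [:: p; x; y; q] by rewrite !inE eqxx.
have inx : x \in [:: p; x; y; q] by rewrite !inE eqxx ?orbT.
have iny : y \in [:: p; x; y; q] by rewrite !inE eqxx ?orbT.
have inq : q \in [:: p; x; y; q] by rewrite !inE eqxx ?orbT.
(* The 15 choices of two distinct pairs among the six pairs of points. *)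
have := (H p x x y inp inx inx iny, H p x p y inp inx inp iny,
  H p x x q inp inx inx inq, H p x p q inp inx inp inq,
  H p x y q inp inx iny inq).
have := (H p y x y inp iny inx iny, H p y x q inp iny inx inq,
  H p y p q inp iny inp inq, H p y y q inp iny iny inq).
have := (H p q x y inp inq inx iny, H p q x q inp inq inx inq,
  H p q y q inp inq iny inq).
have := (H x y x q inx iny inx inq, H x y y q inx iny iny inq,
  H x q y q inx inq iny inq).
have ge0 := locally_orderable_ge0 d0 dC loc.
move: (ge0 p x) (ge0 p y) (ge0 p q) (ge0 x y) (ge0 x q) (ge0 y q).
rewrite !d0 ?(dC x p) ?(dC y p) ?(dC y x) ?(dC q p) ?(dC q x) ?(dC q y).
(* Discards the 40 of the 64 comparison patterns that are not transitive. *)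
have tr u v w : (((rho u <= rho v) == (rho v <= rho w))
    ==> ((rho u <= rho w) == (rho u <= rho v)))%N.
  case: (leqP (rho u)) => uv; case: (leqP (rho v)) => vw //=.
    by rewrite (leq_trans uv vw).
  by rewrite leqNgt (ltn_trans vw uv).
move: px py xq yq xy fxy (tr p x y) (tr p x q) (tr p y q) (tr x y q).
move: (d p x) (d p y) (d p q) (d x y) (d x q) (d y q).
move: (rho p <= rho x)%N (rho p <= rho y)%N (rho p <= rho q)%N.
move: (rho x <= rho y)%N (rho x <= rho q)%N (rho y <= rho q)%N.
clear=> b1 b2 b3 b4 b5 b6 px py pq xy xq yq ? ? ? ? ? ?.
case: b1 b2 b3 b4 b5 b6 => [] [] [] [] [] [] //= _ _ _ _.
all: move=> ? ? ? ? ? ? [[? ?] ?] [[? ?] ?] [[[? ?] ?] ?] [[[[? ?] ?] ?] ?].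
all: split; lra.
Qed.

Lemma locally_orderable_orderable (R : realFieldType) (T : finType)
    (d : T -> T -> R) (d0 : forall x, d x x = 0)
    (dC : forall x y, d x y = d y x) :
  locally_orderable d ->
  exists f : T -> R, forall i r j s,
    f i <= f r -> f j <= f s -> quad_ordered d i r j s.
Proof.
move=> loc; case: (pickP [pred x : T | true]) => [x0 _|T0]; last first.
  by exists (fun=> 0) => i; have := T0 i.
pose az := [arg max_(u > (x0, x0)) d u.1 u.2]%O.
pose a := az.1; pose z := az.2.
have azmax x y : d x y <= d a z.
  by rewrite /a /z /az; case: arg_maxP => //= u _ /(_ (x, y)); apply.
have ge0 := locally_orderable_ge0 d0 dC loc.
have ext := locally_orderable_extremal d0 dC loc.
pose f x := d a x - d x z.
have ends x y : f x <= f y -> d a x + d x y <= d a y /\ d x y + d y z <= d x z.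
  by move=> fxy; have [] := ext a x y z; rewrite ?azmax.
have triple x y t : f x <= f y -> f y <= f t -> d x y + d y t <= d x t.
  move=> fxy fyt; have fxt := le_trans fxy fyt.
  have [[axy xyz] [ayt ytz]] := (ends _ _ fxy, ends _ _ fyt).
  have [axt xtz] := ends _ _ fxt.
  move: (ge0 x y) (ge0 y t) (ge0 x t) (ge0 a x) (ge0 a y) (ge0 y z) (ge0 t z).
  move=> ? ? ? ? ? ? ?; have [dyx dty] := (dC y x, dC t y).
  (* By [ends], [a, t] is a maximal pair of [a, x, y, t]. If [y] has to precede [x], then
     [d x y = 0], and [d y t <= d x t] remains to be shown. *)
  have [le1|/ltW le1] := leP (d a x - d x t) (d a y - d y t).
    by have [||||||_ ? _] := ext a x y t; lra.
  have [||||||? ? _] := ext a y x t; [lra..|].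
  (* Here [x, z] is a maximal pair. If [t] has to precede [y], then [d x t + d t y <= d x y = 0]. *)
  have [le2|/ltW le2] := leP (d x y - d y z) (d x t - d t z).
    by have [||||||? _ _] := ext x y t z; lra.
  by have [||||||? _ _] := ext x t y z; lra.
exists f => i r j s fir fjs; rewrite /quad_ordered.
wlog fij : i r j s fir fjs / f i <= f j.
  move=> IH; have [fij|/ltW fji] := leP (f i) (f j); first exact: IH.
  by have := IH j s i r fjs fir fji; rewrite (dC j i) (dC s r) (dC j r) (dC s i); lra.
(* If [j] precedes [r], two triples and nonnegativity suffice. *)
have [frj|/ltW fjr] := leP (f r) (f j); last first.
  have [frs|/ltW fsr] := leP (f r) (f s).
    by have := triple i j s fij fjs; have := triple j r s fjr frs; have := ge0 j r;
      rewrite (dC j r); lra.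
  have := triple i j s fij fjs; have := triple j s r fjs fsr; have := ge0 j s.
  by rewrite (dC r j) (dC r s); lra.
have tirj := triple i r j fir frj; have trjs := triple r j s frj fjs.
have tijs := triple i j s fij fjs.
have tirs := triple i r s fir (le_trans frj fjs).
move: (ge0 i r) (ge0 r j) (ge0 j s) (ge0 i j) (ge0 r s) => ? ? ? ? ?.
have djr := dC j r.
(* In the order [i, r, j, s] the triples make [i, s] a maximal pair. If [j] has to precede [r], then
   [d r j = 0], [d i j = d i r], and the triple [i, r, s] concludes. *)
have [le1|/ltW le1] := leP (d i r - d r s) (d i j - d j s).
  by have [||||||_ _ ?] := ext i r j s; lra.
by have [||||||? ? _] := ext i j r s; lra.
Qed.

Lemma perm_sorting (R : realDomainType) (n : nat) (f : 'I_n -> R) :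
  exists pi : 'S_n, {homo pi : i j / (i <= j)%N >-> f i <= f j}.
Proof.
pose s := sort (relpre f <=%R) (enum 'I_n).
have s_size : size s = n by rewrite size_sort size_enum_ord.
have s_uniq : uniq s by rewrite sort_uniq enum_uniq.
(* The default [i] is never reached; it avoids assuming that ['I_n] is inhabited. *)
have g_inj : injective (fun i : 'I_n => nth i s i).
  move=> i j; rewrite (set_nth_default i j) ?s_size //= => /eqP.
  by rewrite nth_uniq ?s_size // => /eqP/val_inj.
exists (perm g_inj) => i j le_ij; rewrite !permE (set_nth_default i j) ?s_size //.
have := @sorted_leq_nth _ (relpre f <=%R); apply=> //; rewrite ?inE ?s_size //.
- by move=> y x t /=; apply: le_trans.
- by move=> x /=.
- by apply: sort_sorted => x y /=; apply: le_total.
Qed.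

(** A point of [B] is ranked by its position in the permuted submatrix. Ties in [B] occur only
    between equal points, where the inequality is trivial. *)
Lemma principal_submx_rank (R : realType) (n : nat) (M : 'M[R]_n)
    (B : {set 'I_n}) :
  permuted_a_monge (principal_submx M B) ->
  exists rho : 'I_n -> nat, {in B & &, forall i r j, {in B, forall s,
    (rho i <= rho r)%N -> (rho j <= rho s)%N -> M i s + M r j <= M i j + M r s}}.
Proof.
case=> pi piM; have [->|[x0 x0B]] := set_0Vmem B.
  by exists (fun=> 0%N) => i r j; rewrite inE.
pose k x : 'I_#|B| := (pi^-1)%g (enum_rank_in x0B x).
exists (fun x => k x : 'I__) => i r j iB rB jB s sB ir js.
have pik x : x \in B -> enum_val (pi (k x)) = x.
  by move=> xB; rewrite permKV enum_rankK_in.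
have k_inj : {in B &, injective (fun x => k x : nat)}.
  by move=> x y xB yB /val_inj kxy; rewrite -(pik x xB) kxy pik.
have [|neq_ir] := eqVneq (k i : nat) (k r); first by move/k_inj=> -> //; rewrite addrC.
have [|neq_js] := eqVneq (k j : nat) (k s); first by move/k_inj=> -> //.
have := piM (k i) (k r) (k j) (k s); rewrite !ltn_neqAle neq_ir neq_js.
by rewrite /principal_submx !mxE !pik //; apply.
Qed.

Theorem theoremA2 (R : realType) (n : nat) (M : 'M[R]_n) :
  ~ permuted_a_monge M ->
  exists B : {set 'I_n},
    (#|B| <= 4)%N /\ ~ permuted_a_monge (principal_submx M B).
Proof.
apply: contra_notP => noB.
have loc w x y z : exists rho : 'I_n -> nat,
    {in [:: w; x; y; z] & &, forall i r j, {in [:: w; x; y; z], forall s,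
    (rho i <= rho r)%N -> (rho j <= rho s)%N -> M i s + M r j <= M i j + M r s}}.
  have [|rho rhoP] := @principal_submx_rank R n M [set u in [:: w; x; y; z]].
    apply: contrapT => notB; apply: noB; exists [set u in [:: w; x; y; z]].
    by split=> //; rewrite cardsE (leq_trans (card_size _)).
  by exists rho => i r j iP rP jP s sP; apply: rhoP; rewrite in_set.
pose d x y := M x x + M y y - M x y - M y x.
have d0 x : d x x = 0 by rewrite /d; lra.
have dC x y : d x y = d y x by rewrite /d; lra.
have [|f fP] := locally_orderable_orderable d0 dC.
  move=> w x y z; have [rho rhoP] := loc w x y z; exists rho.
  move=> i r j iP rP jP s sP ir js; rewrite /quad_ordered /d.
  by have := rhoP i r j iP rP jP s sP ir js; have := rhoP j s i jP sP iP r rP js ir; lra.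
have [pi pi_homo] := perm_sorting f; exists pi => i r j s /ltnW ir /ltnW js.
rewrite !mxE; have := fP _ _ _ _ (pi_homo _ _ ir) (pi_homo _ _ js).
move: (pi i) (pi r) (pi j) (pi s) => {ir js} {}i {}r {}j {}s; rewrite /quad_ordered /d.
have [rho rhoP] := loc i r j s.
have [iP rP jP sP] : [/\ i \in [:: i; r; j; s], r \in [:: i; r; j; s],
    j \in [:: i; r; j; s] & s \in [:: i; r; j; s]].
  by split; rewrite !inE eqxx ?orbT.
(* If [rho] orders just one pair the other way, it yields the reverse inequality for [M] and for its
   transpose. The inequality on [d] bounds their sum the other way, so both are equalities. *)
case: (leqP (rho i) (rho r)) => [|/ltnW] ir;
  case: (leqP (rho j) (rho s)) => [|/ltnW] js.
- by have := rhoP i r j iP rP jP s sP ir js; lra.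
- by have := rhoP s j i sP jP iP r rP js ir; have := rhoP i r s iP rP sP j jP ir js; lra.
- by have := rhoP r i j rP iP jP s sP ir js; have := rhoP j s r jP sP rP i iP js ir; lra.
- by have := rhoP r i s rP iP sP j jP ir js; lra.
Qed.
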